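(* Let $\mathcal{G}$ be a finite connected groupoid with $k=|\mathcal{G}_0|$ identities and let $e\in\mathcal{G}_0$. Let $p_1,\dots,p_\ell$ be primes and write $|\mathcal{G}_e|=p_i^{m_i}b_i$ with $\gcd(p_i,b_i)=1$ for all $1\le i\le\ell$. Then for all integers $0\le n_i\le m_i$ ($1\le i\le\ell$) and all integers $1\le d_1,\dots,d_\ell\le k$ with $d=\sum_{i=1}^{\ell}d_i\le k$, there is a subgroupoid $\mathcal{H}$ of $\mathcal{G}$ such that $|\mathcal{H}_0|=d$ and $$|\mathcal{H}|=\sum_{i=1}^{\ell}d_i^2\,p_i^{n_i}.$$
   Context: A groupoid is a nonempty set $\mathcal{G}$ with a partially defined associative operation in which every $g$ has an inverse $g^{-1}$, a right identity $d(g)=g^{-1}g$ (domain) and a left identity $r(g)=gg^{-1}$ (range); the product $gh$ exists if and only if $d(g)=r(h)$. $\mathcal{G}_0$ is the set of identities and $\mathcal{G}_e=\{g:d(g)=r(g)=e\}$ is the isotropy group at $e\in\mathcal{G}_0$. A subgroupoid is a nonempty subset that is a groupoid under the restricted operation. A groupoid is connected if for any identities $e,f$ there is $g$ with $d(g)=e$, $r(g)=f$; then all isotropy groups are isomorphic. *)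

(* Defs.v *)
From mathcomp Require Import all_boot.

Set Implicit Arguments.
Unset Strict Implicit.
Unset Printing Implicit Defensive.

(* A partial product is a map to [option T]: [gmul g h = None] means that gh
   does not exist. [gmulA] says that (gh)l exists if and only if g(hl) does,
   and that they are then equal. *)
Record groupoid (T : Type) := Groupoid {
  gmul : T -> T -> option T;
  ginv : T -> T;
  gdom : T -> T;
  gran : T -> T;
  ginhabited : inhabited T;
  gmulA : forall g h l,
    obind (fun gh => gmul gh l) (gmul g h) = obind (gmul g) (gmul h l);
  gmulVg : forall g, gmul (ginv g) g = Some (gdom g);
  gmulgV : forall g, gmul g (ginv g) = Some (gran g);
  gmulg1 : forall g, gmul g (gdom g) = Some g;
  gmul1g : forall g, gmul (gran g) g = Some g;
  gmul_exists : forall g h, gmul g h <-> gdom g = gran h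
}.

Definition identities (T : finType) (G : groupoid T) : {set T} :=
  [set gdom G g | g : T] :|: [set gran G g | g : T].

Definition isotropy (T : finType) (G : groupoid T) (e : T) : {set T} :=
  [set g | (gdom G g == e) && (gran G g == e)].

Definition connected (T : finType) (G : groupoid T) : Prop :=
  forall e f : T, e \in identities G -> f \in identities G ->
  exists g : T, gdom G g = e /\ gran G g = f.

(* [subgroupoid_mulE] says at once that the carrier is closed under existing
   products and that the product of the subgroupoid is the restricted one. *)
Record subgroupoid (T : finType) (G : groupoid T) := Subgroupoid {
  carrier : {set T};
  subgroupoid_groupoid :> groupoid {x : T | x \in carrier};
  subgroupoid_mulE : forall x y : {x : T | x \in carrier},
    omap val (gmul subgroupoid_groupoid x y) = gmul G (val x) (val y)
}.

(* Main.v *)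
Require Import Defs.
From HB Require Import structures.
From mathcomp Require Import all_boot.
From mathcomp Require Import fingroup pgroup sylow.

(** A connected groupoid is, as soon as an arrow from [e] to every identity
    has been chosen, the product of the pair groupoid on its set of
    identities with the isotropy group at [e]: an arrow is determined by its
    range, its domain and a loop at [e], and these three can be prescribed
    freely ([connected_coordinates]). For a nonempty set [D] of identities and a
    subgroup [K] of the isotropy group, the arrows with both ends in [D] and
    loop in [K] therefore form a subgroupoid with [#|D|] identities and
    [#|D| ^ 2 * #|K|] arrows.

    Since [p i ^ n i] divides the order of the isotropy group, Sylow's theorem
    gives a subgroup [K i] of that order ([group_of_prime_power]), and since
    the [d_ i] add up to at most the number of identities, there are pairwise
    disjoint sets [D i] of [d_ i] identities ([disjoint_subsets]). Arrows
    belonging to different blocks have no end in common, hence are never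
    composable, so the union of the subgroupoids built on the pairs
    [(D i, K i)] is closed and is a subgroupoid
    ([subgroupoid_of_closed]); identities and arrows add up over the blocks. *)

Set Implicit Arguments.
Unset Strict Implicit.
Unset Printing Implicit Defensive.

(** * Calculus of a groupoid with a totalized product *)

(** The default [g], returned when the product does not exist, is arbitrary:
    [cmul] is used on composable pairs only. It trades the [option] of the
    partial product for side conditions [gdom G g = gran G h]. *)
Definition cmul (T : Type) (G : groupoid T) (g h : T) : T :=
  odflt g (gmul G g h).

Lemma gmul_cmul (T : Type) (G : groupoid T) g h :
  gdom G g = gran G h -> gmul G g h = Some (cmul G g h).
Proof. by move=> /(gmul_exists G g h).2; rewrite /cmul; case: (gmul G g h). Qed.

Lemma gmul_SomeE (T : Type) (G : groupoid T) g h x :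
  gmul G g h = Some x -> gdom G g = gran G h /\ cmul G g h = x.
Proof.
by move=> E; split; [apply/(gmul_exists G g h); rewrite E | rewrite /cmul E].
Qed.

Lemma gdom_inv (T : Type) (G : groupoid T) g : gdom G (ginv G g) = gran G g.
Proof. by case: (gmul_SomeE (gmulVg G g)). Qed.

Lemma gran_inv (T : Type) (G : groupoid T) g : gran G (ginv G g) = gdom G g.
Proof. by case: (gmul_SomeE (gmulgV G g)). Qed.

Lemma gran_dom (T : Type) (G : groupoid T) g : gran G (gdom G g) = gdom G g.
Proof. by case: (gmul_SomeE (gmulg1 G g)). Qed.

Lemma gdom_ran (T : Type) (G : groupoid T) g : gdom G (gran G g) = gran G g.
Proof. by case: (gmul_SomeE (gmul1g G g)). Qed.

Lemma gdom_dom (T : Type) (G : groupoid T) g : gdom G (gdom G g) = gdom G g.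
Proof. by rewrite -(gran_inv G g) gdom_ran. Qed.

Lemma gran_ran (T : Type) (G : groupoid T) g : gran G (gran G g) = gran G g.
Proof. by rewrite -(gdom_inv G g) gran_dom. Qed.

Lemma cmulg1 (T : Type) (G : groupoid T) g : cmul G g (gdom G g) = g.
Proof. by rewrite /cmul gmulg1. Qed.

Lemma cmul1g (T : Type) (G : groupoid T) g : cmul G (gran G g) g = g.
Proof. by rewrite /cmul gmul1g. Qed.

Lemma cmulVg (T : Type) (G : groupoid T) g : cmul G (ginv G g) g = gdom G g.
Proof. by rewrite /cmul gmulVg. Qed.

Lemma cmulgV (T : Type) (G : groupoid T) g : cmul G g (ginv G g) = gran G g.
Proof. by rewrite /cmul gmulgV. Qed.

(** Both sides of the associativity axiom at [(g, h, gdom h)] exist, and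
    existence of [(gh)(gdom h)] pins down the domain of [gh]; symmetrically
    for the range. *)
Lemma gdom_mul (T : Type) (G : groupoid T) g h :
  gdom G g = gran G h -> gdom G (cmul G g h) = gdom G h.
Proof.
move=> E; have := gmulA G g h (gdom G h).
rewrite gmulg1 (gmul_cmul E) /= (gmul_cmul E) => /(@gmul_SomeE T G)[-> _].
exact: gran_dom.
Qed.

Lemma gran_mul (T : Type) (G : groupoid T) g h :
  gdom G g = gran G h -> gran G (cmul G g h) = gran G g.
Proof.
move=> E; have := gmulA G (gran G g) g h.
rewrite gmul1g (gmul_cmul E) /= (gmul_cmul E) => /esym/(@gmul_SomeE T G)[<- _].
exact: gdom_ran.
Qed.

Lemma cmulA (T : Type) (G : groupoid T) g h x :
  gdom G g = gran G h -> gdom G h = gran G x ->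
  cmul G g (cmul G h x) = cmul G (cmul G g h) x.
Proof.
move=> E F; have := gmulA G g h x.
rewrite (gmul_cmul E) (gmul_cmul F) /= !gmul_cmul ?gdom_mul ?gran_mul //.
by case.
Qed.

Lemma cmulKg (T : Type) (G : groupoid T) g h :
  gdom G g = gran G h -> cmul G (ginv G g) (cmul G g h) = h.
Proof. by move=> E; rewrite cmulA ?gdom_inv // cmulVg E cmul1g. Qed.

Lemma cmulKVg (T : Type) (G : groupoid T) g h :
  gran G g = gran G h -> cmul G g (cmul G (ginv G g) h) = h.
Proof.
by move=> E; rewrite cmulA ?gran_inv ?gdom_inv // cmulgV E cmul1g.
Qed.

Lemma cmulgK (T : Type) (G : groupoid T) g h :
  gdom G h = gran G g -> cmul G (cmul G h g) (ginv G g) = h.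
Proof. by move=> E; rewrite -cmulA ?gran_inv // cmulgV -E cmulg1. Qed.

Lemma cmulgKV (T : Type) (G : groupoid T) g h :
  gdom G h = gdom G g -> cmul G (cmul G h (ginv G g)) g = h.
Proof.
by move=> E; rewrite -cmulA ?gran_inv ?gdom_inv // cmulVg -E cmulg1.
Qed.

Lemma identities_dom (T : finType) (G : groupoid T) g :
  gdom G g \in identities G.
Proof. by rewrite inE imset_f. Qed.

Lemma identities_ran (T : finType) (G : groupoid T) g :
  gran G g \in identities G.
Proof. by rewrite inE orbC imset_f. Qed.

Lemma gdom_id (T : finType) (G : groupoid T) e :
  e \in identities G -> gdom G e = e.
Proof.
by case/setUP=> /imsetP[g _ ->]; rewrite ?gdom_dom ?gdom_ran.
Qed.

Lemma gran_id (T : finType) (G : groupoid T) e :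
  e \in identities G -> gran G e = e.
Proof.
by case/setUP=> /imsetP[g _ ->]; rewrite ?gran_dom ?gran_ran.
Qed.

(** * Subgroupoids carried by closed subsets *)

(** The groupoid axioms on [S] are inherited because closure makes every
    product, inverse and identity of elements of [S] land in [S]. The
    identities of the result are counted inside [G], so that no use of the
    lemma has to mention the subtype. *)
Lemma subgroupoid_of_closed (T : finType) (G : groupoid T) (S : {set T}) :
  S != set0 ->
  (forall g h, g \in S -> h \in S -> gdom G g = gran G h ->
     cmul G g h \in S) ->
  (forall g, g \in S -> ginv G g \in S) ->
  exists H : subgroupoid G,
    carrier H = S /\ #|identities H| = #|[set gdom G g | g in S]|.
Proof.
move=> /set0Pn[x0 Sx0] SM SV.
have Sd g : g \in S -> gdom G g \in S.
  by move=> Sg; rewrite -cmulVg SM ?SV ?gdom_inv.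
have Sr g : g \in S -> gran G g \in S.
  by move=> Sg; rewrite -gdom_inv Sd ?SV.
pose U := {x : T | x \in S}.
pose mulS (x y : U) : option U := obind insub (gmul G (val x) (val y)).
pose invS (x : U) : U := Sub (ginv G (val x)) (SV _ (valP x)).
pose domS (x : U) : U := Sub (gdom G (val x)) (Sd _ (valP x)).
pose ranS (x : U) : U := Sub (gran G (val x)) (Sr _ (valP x)).
have mulE (x y : U) : omap val (mulS x y) = gmul G (val x) (val y).
  rewrite /mulS; case E: (gmul G _ _) => [z|] //=.
  have [F <-] := gmul_SomeE E.
  by rewrite insubT ?SM ?(valP x) ?(valP y).
have omap_inj : injective (omap (val : U -> T)).
  by move=> [x|] [y|] //= [] /val_inj->.
(* The axioms are read off in [G]: [omap val] is injective and turns [mulS]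
   into the product of [G]. *)
have obind_mulSl (o : option U) z :
    omap val (obind (fun x => mulS x z) o)
      = obind (fun x => gmul G x (val z)) (omap val o).
  by case: o => [x|] //=; rewrite mulE.
have obind_mulSr (o : option U) z :
    omap val (obind (mulS z) o) = obind (gmul G (val z)) (omap val o).
  by case: o => [x|] //=; rewrite mulE.
have A1 x y z : obind (fun xy => mulS xy z) (mulS x y)
                  = obind (mulS x) (mulS y z).
  by apply: omap_inj; rewrite obind_mulSl obind_mulSr !mulE gmulA.
have A2 x : mulS (invS x) x = Some (domS x).
  by apply: omap_inj; rewrite mulE /= gmulVg.
have A3 x : mulS x (invS x) = Some (ranS x).
  by apply: omap_inj; rewrite mulE /= gmulgV.
have A4 x : mulS x (domS x) = Some x.
  by apply: omap_inj; rewrite mulE /= gmulg1.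
have A5 x : mulS (ranS x) x = Some x.
  by apply: omap_inj; rewrite mulE /= gmul1g.
have A6 x y : mulS x y <-> domS x = ranS y.
  have B : mulS x y = gmul G (val x) (val y) :> bool.
    by rewrite -mulE; case: (mulS x y).
  rewrite B; split=> [/(gmul_exists G) | /(congr1 val)] E; first exact: val_inj.
  exact/(gmul_exists G).
pose K := Groupoid (inhabits (Sub x0 Sx0 : U)) A1 A2 A3 A4 A5 A6.
exists (@Subgroupoid T G S K mulE); split=> //.
rewrite -(card_imset (identities K) val_inj); apply: eq_card => f.
apply/imsetP/imsetP=> [[u uK ->] | [g Sg ->]].
  by exists (val u); [exact: valP | rewrite -[in LHS](gdom_id uK)].
by exists (domS (Sub g Sg)); first exact: (identities_dom K).
Qed.

(** * Coordinates on a connected groupoid *)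

(** The membership proof of [e] is an argument because [e] has to be an
    identity for the isotropy set to be a group with unit [e]. *)
Definition isotropy_group (T : finType) (G : groupoid T) (e : T)
  of e \in identities G : Type := {g : T | g \in isotropy G e}.

HB.instance Definition _ (T : finType) (G : groupoid T) (e : T)
  (he : e \in identities G) := Finite.on (isotropy_group he).

Lemma isotropyP (T : finType) (G : groupoid T) (e g : T) :
  reflect (gdom G g = e /\ gran G g = e) (g \in isotropy G e).
Proof. by rewrite inE; apply: (iffP andP) => -[/eqP ? /eqP ?]. Qed.

Lemma isotropy_mul (T : finType) (G : groupoid T) (e g h : T) :
  g \in isotropy G e -> h \in isotropy G e -> cmul G g h \in isotropy G e.
Proof.
move=> /isotropyP[dg rg] /isotropyP[dh rh]; apply/isotropyP.
by rewrite gdom_mul ?gran_mul // dg rh.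
Qed.

Lemma isotropy_inv (T : finType) (G : groupoid T) (e g : T) :
  g \in isotropy G e -> ginv G g \in isotropy G e.
Proof.
by case/isotropyP=> dg rg; apply/isotropyP; rewrite gdom_inv gran_inv.
Qed.

Lemma isotropy_id (T : finType) (G : groupoid T) (e : T) :
  e \in identities G -> e \in isotropy G e.
Proof. by move=> he; apply/isotropyP; rewrite gdom_id ?gran_id. Qed.

Definition isotropy_group_mul (T : finType) (G : groupoid T) (e : T)
    (he : e \in identities G) (x y : isotropy_group he) : isotropy_group he :=
  exist (fun z => z \in isotropy G e) _ (isotropy_mul (valP x) (valP y)).

Definition isotropy_group_inv (T : finType) (G : groupoid T) (e : T)
    (he : e \in identities G) (x : isotropy_group he) : isotropy_group he :=
  exist (fun z => z \in isotropy G e) _ (isotropy_inv (valP x)).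

Definition isotropy_group_one (T : finType) (G : groupoid T) (e : T)
    (he : e \in identities G) : isotropy_group he :=
  exist (fun z => z \in isotropy G e) _ (isotropy_id he).

Lemma isotropy_group_mulA (T : finType) (G : groupoid T) (e : T)
    (he : e \in identities G) : associative (@isotropy_group_mul T G e he).
Proof.
move=> [x xG] [y yG] [z zG]; apply: val_inj => /=.
move: xG yG zG => /isotropyP[dx rx] /isotropyP[dy ry] /isotropyP[dz rz].
by rewrite cmulA // ?dx ?dy ?ry ?rz.
Qed.

Lemma isotropy_group_mul1 (T : finType) (G : groupoid T) (e : T)
    (he : e \in identities G) :
  left_id (isotropy_group_one he) (@isotropy_group_mul T G e he).
Proof.
move=> [x xG]; apply: val_inj => /=.
by case/isotropyP: xG => _ rx; rewrite -{1}rx cmul1g.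
Qed.

Lemma isotropy_group_mulV (T : finType) (G : groupoid T) (e : T)
    (he : e \in identities G) :
  left_inverse (isotropy_group_one he) (@isotropy_group_inv T G e he)
               (@isotropy_group_mul T G e he).
Proof.
move=> [x xG]; apply: val_inj => /=.
by rewrite cmulVg; case/isotropyP: xG.
Qed.

HB.instance Definition _ (T : finType) (G : groupoid T) (e : T)
    (he : e \in identities G) :=
  Finite_isGroup.Build (isotropy_group he) (@isotropy_group_mulA T G e he)
    (@isotropy_group_mul1 T G e he) (@isotropy_group_mulV T G e he).

(** Fix for every identity [f] an arrow [t f] from [e] to [f]. Conjugation
    [g |-> (t (ran g))^-1 g (t (dom g))] turns arrows into loops at [e], the
    inner [t]'s of a product cancel, and [g] is recovered from its two ends
    and its loop: a connected groupoid is the pair groupoid of its identities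
    times its isotropy group. *)
Lemma connected_coordinates (T : finType) (G : groupoid T) (e : T)
    (he : e \in identities G) :
  connected G ->
  exists c : T -> isotropy_group he,
  [/\ forall g h, gdom G g = gran G h -> c (cmul G g h) = (c g * c h)%g,
      injective (fun g => (gran G g, gdom G g, c g))
    & forall f f' a, f \in identities G -> f' \in identities G ->
        exists g, [/\ gran G g = f, gdom G g = f' & c g = a]].
Proof.
move=> hG.
pose t f := odflt e [pick x | (gdom G x == e) && (gran G x == f)].
have tP f : f \in identities G -> gdom G (t f) = e /\ gran G (t f) = f.
  move=> hf; rewrite /t; case: pickP => [x /andP[/eqP-> /eqP->] // | N].
  by have [x [dx rx]] := hG e f he hf; have:= N x; rewrite dx rx !eqxx.
have td f : f \in identities G -> gdom G (t f) = e by move=> /tP[].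
have tr f : f \in identities G -> gran G (t f) = f by move=> /tP[].
have dI := identities_dom G; have rI := identities_ran G.
pose loop g := cmul G (ginv G (t (gran G g))) (cmul G g (t (gdom G g))).
have loopP g : loop g \in isotropy G e.
  by apply/isotropyP; rewrite gdom_mul ?gran_mul ?gdom_mul ?gran_mul
    ?gdom_inv ?gran_inv ?tr ?td.
exists (fun g => exist (fun z => z \in isotropy G e) _ (loopP g)); split.
- move=> g h E; apply: val_inj; rewrite /= /loop gdom_mul ?gran_mul //.
  set x := t (gran G g); set y := t (gdom G h); rewrite E; set z := t _.
  have rz : gran G z = gran G h by rewrite tr.
  have rx : gran G x = gran G g by rewrite tr.
  have ry : gran G y = gdom G h by rewrite tr.
  rewrite -[RHS]cmulA ?gdom_mul ?gran_mul ?gdom_inv ?gran_inv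
    ?gran_mul ?gdom_mul ?rz ?rx ?ry ?gran_inv ?gran_mul //.
  congr cmul.
  by rewrite -[RHS]cmulA ?cmulKVg ?gran_mul ?gdom_inv ?gran_inv ?gran_mul
     ?ry ?rz // cmulA ?ry.
- move=> g h [rE dE] /(congr1 (cmul G (t (gran G g)))).
  rewrite /loop -rE -dE !cmulKVg ?gran_mul ?tr -?rE -?dE //.
  move/(congr1 (fun x => cmul G x (ginv G (t (gdom G g))))).
  by rewrite !cmulgK ?tr -?dE.
move=> f f' [a aG] hf hf'; have [da ra] := isotropyP _ _ _ aG.
have [df rf] := tP f hf; have [df' rf'] := tP f' hf'.
have E1 : gdom G a = gran G (ginv G (t f')) by rewrite gran_inv da.
have E2 : gdom G (t f) = gran G (cmul G a (ginv G (t f'))).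
  by rewrite gran_mul // ra.
have rg : gran G (cmul G (t f) (cmul G a (ginv G (t f')))) = f.
  by rewrite gran_mul.
have dg : gdom G (cmul G (t f) (cmul G a (ginv G (t f')))) = f'.
  by rewrite !gdom_mul // gdom_inv.
exists (cmul G (t f) (cmul G a (ginv G (t f')))); split=> //.
apply: val_inj; rewrite /= /loop rg dg.
have E3 : gdom G (cmul G a (ginv G (t f'))) = gran G (t f').
  by rewrite gdom_mul // gdom_inv.
rewrite -cmulA // cmulgKV ?da ?df' // cmulKg // df.
exact: esym ra.
Qed.

(** * The counting ingredients *)

(** Sylow's theorem reduces the claim to a [p]-group, and a [p]-group has
    normal subgroups of every order that its own order allows. *)
Lemma group_of_prime_power (gT : finGroupType) (p n : nat) :
  prime p -> p ^ n %| #|gT| -> exists H : {group gT}, #|H| = p ^ n.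
Proof.
move=> pp pn_dvd; have [P sylP] := Sylow_exists p [set: gT]%G.
have [|Q [_ _ <-]] :=
    normal_pgroup (r := n) (pHall_pgroup sylP) (normal_refl P); last first.
  by exists Q.
have gT_gt0 : 0 < #|gT| by apply/card_gt0P; exists 1%g.
by rewrite (card_Hall sylP) cardsT p_part pfactorK // -pfactor_dvdn.
Qed.

(** The disjoint union of the types ['I_(d i)] injects into [A] for reasons
    of cardinality; the images of its summands are the required subsets. *)
Lemma disjoint_subsets (T : finType) (A : {set T}) (l : nat) (d : 'I_l -> nat) :
  \sum_(i < l) d i <= #|A| ->
  exists D : 'I_l -> {set T},
  [/\ forall i, D i \subset A, forall i, #|D i| = d i
    & forall i j f, f \in D i -> f \in D j -> i = j].
Proof.
move=> dA; pose I := {i : 'I_l & 'I_(d i)}.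
have leIA : #|{: I}| <= #|A|.
  rewrite card_tagged sumnE big_map big_enum /=.
  by under eq_bigr do rewrite card_ord.
pose f (x : I) : T := enum_val (widen_ord leIA (enum_rank x)).
have f_inj : injective f.
  move=> x y /enum_val_inj/(congr1 val)/= E.
  by apply: enum_rank_inj; apply: val_inj.
exists (fun i => [set f (Tagged (fun i => 'I_(d i)) j) | j : 'I_(d i)]); split.
- by move=> i; apply/subsetP=> _ /imsetP[j _ ->]; apply: enum_valP.
- move=> i; rewrite card_imset ?card_ord // => j j' /f_inj E.
  exact: eq_from_Tagged E.
by move=> i j _ /imsetP[x _ ->] /imsetP[y _ /f_inj/(congr1 tag)].
Qed.

Lemma card_bigcup_disjoint (T I : finType) (F : I -> {set T}) :
  (forall i j x, x \in F i -> x \in F j -> i = j) ->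
  #|\bigcup_i F i| = \sum_i #|F i|.
Proof.
move=> dis; rewrite -sum1_card partition_disjoint_bigcup => [|i j ij].
  by apply: eq_bigr => i _; rewrite sum1_card.
rewrite -setI_eq0; apply/set0Pn => -[x /setIP[xi xj]].
by rewrite (dis _ _ _ xi xj) eqxx in ij.
Qed.

(** * Gluing blocks with prescribed isotropy *)

Theorem theorem5p9 (T : finType) (G : groupoid T) (hG : connected G)
    (k : nat) (hk : k = #|identities G|) (e : T) (he : e \in identities G)
    (l : nat) (hl : 0 < l) (p m b : 'I_l -> nat)
    (hp : forall i, prime (p i))
    (hGe : forall i, #|isotropy G e| = p i ^ m i * b i)
    (hb : forall i, coprime (p i) (b i))
    (n : 'I_l -> nat) (hn : forall i, n i <= m i)
    (d_ : 'I_l -> nat) (hd_ : forall i, 1 <= d_ i <= k)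
    (d : nat) (hd : d = \sum_(i < l) d_ i) (hdk : d <= k) :
  exists H : subgroupoid G,
    #|identities H| = d /\
    #|carrier H| = \sum_(i < l) d_ i ^ 2 * p i ^ n i.
Proof.
have [c [cM cI cS]] := connected_coordinates he hG.
have [K oK] : exists K : 'I_l -> {group isotropy_group he},
    forall i, #|K i| = p i ^ n i.
  have oE i : #|{: isotropy_group he}| = p i ^ m i * b i.
    by rewrite -hGe card_sig; apply: eq_card.
  have KP i : exists K : {group isotropy_group he}, #|K| == p i ^ n i.
    have [|K <-] := @group_of_prime_power (isotropy_group he) _ (n i) (hp i).
      by rewrite (oE i) dvdn_mulr // dvdn_exp2l.
    by exists K.
  exists (fun i => xchoose (KP i)) => i; exact/eqP/(xchooseP (KP i)).
have [|D [DG oD disD]] := @disjoint_subsets T (identities G) l d_.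
  by rewrite -hd -hk.
pose S i := [set g | [&& gran G g \in D i, gdom G g \in D i & c g \in K i]].
have SP i g : reflect [/\ gran G g \in D i, gdom G g \in D i & c g \in K i]
                      (g \in S i) by rewrite inE; apply: and3P.
(* Functoriality alone makes [c] trivial on identities, which are idempotent. *)
have c_id f : f \in identities G -> c f = 1%g.
  move=> hf; apply: (mulgI (c f)); rewrite -cM ?gdom_id ?gran_id //.
  by rewrite mulg1 -{2}(gdom_id hf) cmulg1.
have c_inv g : c (ginv G g) = (c g)^-1%g.
  apply: (mulIg (c g)).
  by rewrite mulVg -cM ?gdom_inv // cmulVg c_id ?identities_dom.
have idS i f : f \in D i -> f \in S i.
  move=> fD; have hf := subsetP (DG i) f fD.
  by apply/SP; rewrite gran_id ?gdom_id ?c_id ?group1.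
have [||| H [HS HI]] := @subgroupoid_of_closed T G (\bigcup_i S i).
- apply/set0Pn; pose i0 := Ordinal hl.
  have /card_gt0P[f fD] : 0 < #|D i0| by rewrite oD; case/andP: (hd_ i0).
  by exists f; apply/bigcupP; exists i0 => //; apply: idS.
- move=> g h /bigcupP[i _ /SP[rg dg cg]] /bigcupP[j _ /SP[rh dh ch]] E.
  (* Disjointness of the [D i] is what keeps products inside one block. *)
  have ij : i = j by apply: (disD _ _ (gdom G g)); rewrite ?E // -E.
  subst j; apply/bigcupP; exists i => //; apply/SP.
  by rewrite gran_mul ?gdom_mul ?cM ?groupM.
- move=> g /bigcupP[i _ /SP[rg dg cg]]; apply/bigcupP; exists i => //.
  by apply/SP; rewrite gran_inv gdom_inv c_inv groupV.
exists H; split.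
  have -> : #|identities H| = #|\bigcup_i D i|.
    rewrite HI; apply: eq_card => f; apply/imsetP/bigcupP.
      by case=> g /bigcupP[i _ /SP[_ dg _]] ->; exists i.
    case=> i _ fD; exists f; first by apply/bigcupP; exists i; rewrite ?idS.
    by rewrite gdom_id // (subsetP (DG i)).
  by rewrite card_bigcup_disjoint // hd; apply: eq_bigr.
rewrite HS card_bigcup_disjoint => [|i j g /SP[ri _ _] /SP[rj _ _]]; last first.
  exact: disD ri rj.
apply: eq_bigr => i _; rewrite -(card_imset (S i) cI).
have -> : [set (gran G g, gdom G g, c g) | g in S i]
            = setX (setX (D i) (D i)) (K i).
  apply/setP=> -[[f f'] a]; rewrite !inE -andbA; apply/imsetP/and3P.
    by case=> g /SP[rg dg cg] [-> -> ->].
  case=> fD f'D aK.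
  have [g [rg dg cg]] := cS f f' a (subsetP (DG i) _ fD) (subsetP (DG i) _ f'D).
  by exists g; [apply/SP; rewrite rg dg cg | rewrite rg dg cg].
by rewrite !cardsX oD oK mulnn.
Qed.
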